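(* Let $\alpha\in(0,1)$. For some $m\in\mathbb R$ consider the functional $b_m\colon F\mapsto d_\alpha(F)(m)\in[0,\infty)$, specifying half of the length of the shortest $\alpha$-prediction interval with midpoint $m$. Then: (i) $b_m$ is identifiable on $\mathcal M_{\mathrm{inc,cont}}$ with a strict identification function $V\colon[0,\infty)\times\mathbb R\to\mathbb R$, $V(x,y)=\mathbf 1\{y\in[m-x,m+x]\}-\alpha$. (ii) $b_m$ is elicitable on $\mathcal M_{\mathrm{inc,cont}}$. If $\mu$ is a finite non-negative measure on $[0,\infty)$, then $S\colon[0,\infty)\times\mathbb R\to\mathbb R$, $$S(x,y)=\int_{[0,x)}V(z,y)\,d\mu(z)=\mu\big([0,x)\cap[|y-m|,\infty)\big)-\alpha\mu\big([0,x)\big),$$ is an $\mathcal M_{\mathrm{inc,cont}}$-consistent scoring function for $b_m$. It is strictly $\mathcal M_{\mathrm{inc,cont}}$-consistent if $\mu$ is positive.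
   Context: $\mathcal M_{\mathrm{inc,cont}}$ is the class of probability distributions on $\mathbb R$ whose distribution functions are continuous and strictly increasing on $\mathbb R$. $d_\alpha(F)(m)=\inf\{c\ge0:F([m-c,m+c])\ge\alpha\}$. A measure $\mu$ on $[0,\infty)$ is positive if every nonempty (relatively) open subset has positive measure. $\bar V(x,F)=\int V(x,y)\,dF(y)$, $\bar S(x,F)=\int S(x,y)\,dF(y)$. $V$ is a strict $\mathcal M'$-identification function for $T\colon\mathcal M'\to\mathsf A$ if for all $x\in\mathsf A,F\in\mathcal M'$: $\bar V(x,F)=0$ iff $x=T(F)$. $S$ is $\mathcal M'$-consistent for $T$ if $\bar S(T(F),F)\le\bar S(x,F)$ for all $x\in\mathsf A,F\in\mathcal M'$, strictly so if equality implies $x=T(F)$. $T$ is elicitable (identifiable) on $\mathcal M'$ if a strictly $\mathcal M'$-consistent scoring function with finite expectations (a strict $\mathcal M'$-identification function) exists. *)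

(* Defs.v *)
From HB Require Import structures.
From mathcomp Require Import all_boot all_order all_algebra.
From mathcomp Require Import all_classical all_reals all_analysis.

Set Implicit Arguments.
Unset Strict Implicit.
Unset Printing Implicit Defensive.

Import Order.TTheory GRing.Theory Num.Theory.
Import numFieldNormedType.Exports.

Local Open Scope classical_set_scope.
Local Open Scope ring_scope.

(* The half-line [0, +oo[ as a type, with its subspace topology and its trace
   Borel sigma-algebra: the measurable sets are the preimages under the
   inclusion of the Borel sets of R. *)
Definition halfline (R : realType) : Type :=
  set_type (`[0, +oo[%classic : set R).

Definition hval (R : realType) (x : halfline R) : measurableTypeR R := \val x.

Fact mem_halfline (R : realType) (x : R) :
  0 <= x -> x \in (`[0, +oo[%classic : set R).
Proof. by move=> x0; rewrite inE /= in_itv /= x0. Qed.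

Definition HalfLine (R : realType) (x : R) (x0 : 0 <= x) : halfline R :=
  exist _ x (mem_halfline x0).

HB.instance Definition _ (R : realType) := Topological.on (halfline R).
HB.instance Definition _ (R : realType) :=
  isPointed.Build (halfline R) (HalfLine (lexx 0)).
HB.instance Definition _ (R : realType) :=
  Measurable.copy (halfline R) (g_sigma_algebra_preimageType (@hval R)).

(* A probability distribution on R; [measurableTypeR R] is R with its Borel
   sigma-algebra. *)
Notation distr R := (probability (measurableTypeR R) R).

(* The identity on R as a random variable, so that [dist_fun F] is the library's
   cumulative distribution function t |-> F(]-oo, t]). *)
Definition idTR (R : realType) : measurableTypeR R -> R := idfun.
HB.instance Definition _ (R : realType) :=
  @isMeasurableFun.Build _ _ _ _ (@idTR R) (@measurable_id _ _ setT).

Definition dist_fun (R : realType) (F : distr R) : R -> \bar R :=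
  cdf (@idTR R : {RV F >-> R}).

Definition M_inc_cont (R : realType) : set (distr R) :=
  [set F | continuous (dist_fun F) /\
           {homo dist_fun F : s t / (s < t)%R >-> (s < t)%E}].

Section elicitation.
Context (R : realType) (A : Type).
Implicit Types (M : set (distr R)) (T : distr R -> A) (U : A -> R -> R).

Definition expected U (x : A) (F : distr R) : \bar R :=
  \int[F]_y (U x y)%:E.

(* The library's integral is total: it is the difference of the integrals of
   the positive and negative parts, with a conventional value if both are
   infinite or if the integrand is not measurable. This condition says that the
   integrals defining [expected U x F] exist, possibly as infinite values. *)
Definition has_expectations M U : Prop :=
  forall (x : A) (F : distr R), M F ->
    measurable_fun [set: measurableTypeR R] (U x) /\
    ((\int[F]_y ((fun y => (U x y)%:E)^\+ y) < +oo)%E \/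
     (\int[F]_y ((fun y => (U x y)%:E)^\- y) < +oo)%E).

Definition finite_expectations M U : Prop :=
  forall (x : A) (F : distr R), M F ->
    F.-integrable [set: measurableTypeR R] (fun y => (U x y)%:E).

Definition strict_identification_function M T U : Prop :=
  has_expectations M U /\
  forall (x : A) (F : distr R), M F -> (expected U x F = 0%E <-> x = T F).

Definition consistent M T U : Prop :=
  has_expectations M U /\
  forall (x : A) (F : distr R), M F ->
    (expected U (T F) F <= expected U x F)%E.

Definition strictly_consistent M T U : Prop :=
  consistent M T U /\
  forall (x : A) (F : distr R), M F ->
    expected U (T F) F = expected U x F -> x = T F.

Definition identifiable M T : Prop :=
  exists V : A -> R -> R, strict_identification_function M T V.

Definition elicitable M T : Prop :=
  exists S : A -> R -> R,
    finite_expectations M S /\ strictly_consistent M T S.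

End elicitation.

Section interval_with_midpoint.
Context (R : realType).
Implicit Types (alpha m : R) (F : distr R).

Definition half_lengths alpha F m : set R :=
  [set c | 0 <= c /\ (alpha%:E <= F `[(m - c)%R, (m + c)%R]%classic)%E].

(* [inf] is the infimum in R, with value 0 on the empty set; for alpha < 1 the
   set of half-lengths is nonempty. *)
Definition d_half alpha F m : R := inf (half_lengths alpha F m).

Fact d_half_ge0 alpha F m : 0 <= d_half alpha F m.
Proof.
rewrite /d_half; have [->|/set0P ne] := eqVneq (half_lengths alpha F m) set0.
  by rewrite inf0.
by apply: lb_le_inf => // c [].
Qed.

Definition b_half alpha m : distr R -> halfline R :=
  fun F => HalfLine (d_half_ge0 alpha F m).

Definition V_half alpha m (x : halfline R) (y : R) : R :=
  (y \in `[m - hval x, m + hval x])%:R - alpha.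

Definition below (x : halfline R) : set (halfline R) :=
  [set z | hval z < hval x].

Definition S_half alpha m (mu : {finite_measure set (halfline R) -> \bar R})
    (x : halfline R) (y : R) : R :=
  \int[mu]_(z in below x) V_half alpha m z y.

Definition positive_measure
    (mu : {finite_measure set (halfline R) -> \bar R}) : Prop :=
  forall U : set (halfline R), open U -> U !=set0 -> (0 < mu U)%E.

End interval_with_midpoint.

(* Main.v *)
Require Import Defs.
From HB Require Import structures.
From mathcomp Require Import all_boot all_order all_algebra.
From mathcomp Require Import all_classical all_reals all_analysis.
From mathcomp Require Import measurable_realfun lra.

Import Order.TTheory GRing.Theory Num.Theory.
Import numFieldNormedType.Exports.

Local Open Scope classical_set_scope.
Local Open Scope ring_scope.

(** A distribution F with continuous strictly increasing distribution function
    has no atoms, so the coverage c |-> F [m - c, m + c] is continuous and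
    strictly increasing from 0 towards 1. It therefore takes the value alpha at
    exactly one c, namely at the half-length t = b_m(F), and the expectation of
    V(x, .) is coverage(x) - alpha. By Fubini the expected score at x is the
    mu-integral of coverage - alpha over [0, x). Hence its excess over the
    expected score at t is the mu-integral of a nonnegative function which is
    positive strictly between x and t; that set is open, and nonempty when x
    differs from t, so the excess is positive if mu is positive. *)

(** * Coverage of symmetric intervals under a continuous, strictly increasing distribution
    function *)

Definition distf {R : realType} (F : distr R) (t : R) : R := fine (dist_fun F t).

Definition coverage {R : realType} (F : distr R) (m c : R) : R :=
  fine (F `[(m - c)%R, (m + c)%R]%classic).

Section continuous_increasing_distributions.
Context {R : realType} (F : distr R).

Lemma dist_funE (t : R) : dist_fun F t = F `]-oo, t]%classic.
Proof. by []. Qed.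

Lemma dist_fun_fin_num (t : R) : dist_fun F t \is a fin_num.
Proof. by rewrite dist_funE fin_num_measure. Qed.

Lemma distf_oc (a b : R) : a <= b ->
  fine (F `]a, b]%classic) = distf F b - distf F a.
Proof.
move=> ab; have -> : `]a, b]%classic = `]-oo, b]%classic `\` `]-oo, a]%classic.
  apply/seteqP; split => t /=; rewrite !in_itv/=.
    by move=> /andP[at_ ->]; split => //; apply/negP; rewrite -ltNge.
  by move=> [-> /negP]; rewrite -ltNge => ->.
rewrite measureD//; last by rewrite ltey_eq fin_num_measure.
rewrite setIidr; last by apply: subset_itvl; rewrite bnd_simp.
by rewrite fineB ?fin_num_measure.
Qed.

Hypothesis FM : M_inc_cont F.

Lemma continuous_distf : continuous (distf F).
Proof.
move=> t; apply: fine_cvg.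
by rewrite fineK ?dist_fun_fin_num//; exact: FM.1.
Qed.

Lemma distf_increasing : {homo distf F : s t / s < t}.
Proof. by move=> s t st; rewrite fine_lt ?dist_fun_fin_num//; exact: FM.2. Qed.

(** The distribution function measures half-open intervals, so the closed interval differs from them
    by the atom at its left end. Inclusion gives one inequality. For the other, the left end is
    moved slightly outwards and continuity at [m - c] absorbs the error. *)
Lemma coverageE (m c : R) : 0 <= c ->
  coverage F m c = distf F (m + c) - distf F (m - c).
Proof.
move=> c0; have mcmc : m - c <= m + c by lra.
apply/eqP; rewrite eq_le; apply/andP; split; last first.
  rewrite -distf_oc// fine_le ?fin_num_measure// le_measure ?inE//.
  by apply: subitvPl; rewrite bnd_simp.
rewrite -lerBDl -lerN2 opprB opprK.
apply/ler_addgt0Pr => e e0.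
have /cvgrPdist_le/(_ _ e0) := @continuous_distf (m - c).
move=> /nbhs_ballP[d /= d0 /(_ (m - c - d / 2))].
rewrite /ball/= opprB addrCA subrr addr0 ger0_norm; last by rewrite divr_ge0// ltW.
have d2 : d / 2 < d by lra.
(* By contraposition: if the bound failed by more than [e], then [distf F] would drop by more than
   [e] between [m - c] and [m - c - d / 2], because []m - c - d / 2, m + c]] contains the closed
   interval. *)
move=> /(_ d2); apply: contraPP => /negP; rewrite -ltNge => h.
apply/negP; rewrite -ltNge (lt_le_trans _ (ler_norm _))//.
suff : coverage F m c <= distf F (m + c) - distf F (m - c - d / 2) by lra.
rewrite -distf_oc; last by lra.
rewrite fine_le ?fin_num_measure// le_measure ?inE//.
by apply: subitvPl; rewrite bnd_simp; lra.
Qed.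

Lemma coverage_increasing (m c c' : R) : 0 <= c -> c < c' ->
  coverage F m c < coverage F m c'.
Proof.
move=> c0 cc'; rewrite !coverageE//; last by lra.
have h1 : distf F (m + c) < distf F (m + c') by apply: distf_increasing; lra.
have h2 : distf F (m - c') < distf F (m - c) by apply: distf_increasing; lra.
lra.
Qed.

Lemma coverage_gt (a m : R) : a < 1 -> exists2 c, 0 <= c & a < coverage F m c.
Proof.
move=> a1; pose e := (1 - a) / 3.
have e0 : 0 < e by rewrite /e; lra.
have /cvgrPdist_lt/(_ _ e0)[A [_ hA]] : distf F t @[t --> +oo] --> (1 : R).
  by apply: fine_cvg; exact: cvg_cdfy1.
have /cvgrPdist_lt/(_ _ e0)[B [_ hB]] : distf F t @[t --> -oo] --> (0 : R).
  by apply: fine_cvg; exact: cvg_cdfNy0.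
(* Large enough to put [m + c] beyond [A] and [m - c] before [B]; the summand 1 makes both
   strict. *)
pose c := `|m| + `|A| + `|B| + 1.
have [mm mm' AA BB] : [/\ m <= `|m|, - m <= `|m|, A <= `|A| & - B <= `|B|].
  by split; rewrite ?ler_norm// -normrN ler_norm.
have [m0 A0 B0] : [/\ 0 <= `|m|, 0 <= `|A| & 0 <= `|B|] by [].
exists c; first by rewrite /c; lra.
have /hA : A < m + c by rewrite /c; lra.
have /hB : m - c < B by rewrite /c; lra.
rewrite !ltr_distl => /andP[h1 h2] /andP[h3 h4].
rewrite coverageE; last by rewrite /c; lra.
by move: h1 h2 h3 h4; rewrite /e; lra.
Qed.

Lemma coverage0 (m : R) : coverage F m 0 = 0.
Proof. by rewrite coverageE// addr0 subr0 subrr. Qed.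

Lemma coverage_b_half (alpha m : R) : 0 < alpha -> alpha < 1 ->
  coverage F m (hval (b_half alpha m F)) = alpha.
Proof.
move=> a0 a1; have [N N0 hN] := coverage_gt alpha m a1.
have [c c0N cE] : exists2 c, c \in `[0, N] & coverage F m c = alpha.
  (* The intermediate value theorem is applied to the difference, which is continuous on all of R
     and agrees with the coverage for nonnegative arguments. *)
  have [] := @IVT _ (fun c => distf F (m + c) - distf F (m - c)) 0 N alpha N0.
  - apply: continuous_subspaceT => c.
    apply: cvgB; (apply: (@cvg_comp _ _ _ _ (distf F)); last exact: continuous_distf).
      by apply: cvgD; [exact: cvg_cst|exact: cvg_id].
    by apply: cvgB; [exact: cvg_cst|exact: cvg_id].
  - rewrite -!coverageE// coverage0 ge_min le_max (ltW a0) (ltW hN).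
    by rewrite orbT.
  - move=> c cN <-; exists c => //; rewrite coverageE//.
    by move: cN; rewrite in_itv => /andP[].
have {N N0 hN c0N} c0 : 0 <= c by move: c0N; rewrite in_itv => /andP[].
suff -> : hval (b_half alpha m F) = c by [].
(* As the coverage increases strictly, the admissible half-lengths are exactly the numbers from [c]
   on, so the infimum is attained at [c]. *)
rewrite /hval/= /d_half; suff -> : half_lengths alpha F m = `[c, +oo[%classic.
  by rewrite inf_itv.
apply/seteqP; split => x /=; rewrite in_itv/= andbT.
  move=> [x0]; rewrite -[F _]fineK ?fin_num_measure// lee_fin -/(coverage F m x).
  rewrite -cE; apply: contraTT; rewrite -!ltNge => xc.
  exact: coverage_increasing.
move=> cx; split; first exact: le_trans cx.
rewrite -[F _]fineK ?fin_num_measure// lee_fin -/(coverage F m x) -cE.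
by move: cx; rewrite le_eqVlt => /predU1P[->//|/(coverage_increasing m _ _ c0)/ltW].
Qed.

End continuous_increasing_distributions.

(** * Measurability on the half-line *)

Section halfline_measurability.
Context {R : realType}.
Implicit Types (x z : halfline R) (m : R).

Lemma hval_ge0 x : 0 <= hval x.
Proof. by have := set_valP x; rewrite /= in_itv /= andbT. Qed.

Lemma hval_inj : injective (@hval R).
Proof. exact: val_inj. Qed.

Lemma measurable_hval : measurable_fun [set: halfline R] (@hval R).
Proof. by move=> _ B mB; exists B. Qed.

Lemma measurable_below x : measurable (below x).
Proof.
exists `]-oo, (hval x)[%classic; first exact: measurable_itv.
by rewrite setTI; apply/seteqP; split => z; rewrite /= in_itv.
Qed.

Lemma V_halfE (alpha m : R) z (y : R) :
  V_half alpha m z y = (`|y - m| <= hval z)%R%:R - alpha.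
Proof. by rewrite /V_half in_itv/= ler_distl. Qed.

(** Joint measurability in the observation and the half-length is what Fubini requires; the set
    compares two measurable functions on the product. *)
Lemma measurable_le_hval m :
  measurable [set p : measurableTypeR R * halfline R | `|p.1 - m| <= hval p.2].
Proof.
pose f (p : measurableTypeR R * halfline R) : R := `|p.1 - m|.
pose g (p : measurableTypeR R * halfline R) : R := hval p.2.
have mf : measurable_fun setT f.
  by apply: measurableT_comp => //; apply: measurable_funB => //; exact: measurable_fst.
have mg : measurable_fun setT g.
  exact: (measurableT_comp measurable_hval measurable_snd).
rewrite -[X in measurable X]setTI.
exact: (measurable_fun_ler mf mg measurableT I : measurable (setT `&` _ @^-1` [set true])).
Qed.

Lemma measurable_V_half (alpha m : R) :
  measurable_fun [set: measurableTypeR R * halfline R]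
    (fun p => V_half alpha m p.2 p.1).
Proof.
rewrite (_ : (fun _ => _) = (fun p => \1_[set q : measurableTypeR R * halfline R |
   `|q.1 - m| <= hval q.2] p - alpha : R)).
  by apply: measurable_funB => //; apply: measurable_indic; exact: measurable_le_hval.
by apply/funext => p; rewrite V_halfE indicE mem_setE.
Qed.

End halfline_measurability.

(** * Integrability and expected scores by Fubini *)

Lemma bounded_integrable {d} {T : measurableType d} {R : realType}
    (mu : {measure set T -> \bar R}) (f : T -> R) (M : R) :
  (mu [set: T] < +oo)%E -> measurable_fun [set: T] f -> (forall x, `|f x| <= M) ->
  mu.-integrable [set: T] (EFin \o f).
Proof.
move=> muT mf fM; apply: measurable_bounded_integrable => //.
by exists M; split => [|N MN x _]; [exact: num_real|exact: le_trans (fM x) (ltW MN)].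
Qed.

Section expected_scores.
Context {R : realType} (alpha m : R).
Hypotheses (alpha_gt0 : 0 < alpha) (alpha_lt1 : alpha < 1).
Implicit Types (F : distr R) (mu : {finite_measure set (halfline R) -> \bar R}).

Let V := V_half alpha m.

Lemma V_half_le1 z y : `|V z y| <= 1.
Proof.
move: alpha_gt0 alpha_lt1 => a0 a1; have h0 : -1 <= 0 - alpha <= 1 by lra.
have h1 : -1 <= 1 - alpha <= 1 by lra.
by rewrite /V V_halfE ler_norml; case: (`|y - m| <= _).
Qed.

Lemma measurable_V_half1 y : measurable_fun [set: halfline R] (V ^~ y).
Proof. exact: (measurable_fun_pair2 y (measurable_V_half alpha m)). Qed.

Lemma measurable_V_half2 z : measurable_fun [set: measurableTypeR R] (V z).
Proof. exact: (measurable_fun_pair1 z (measurable_V_half alpha m)). Qed.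

Lemma integrable_V_half F z :
  F.-integrable [set: measurableTypeR R] (fun y => (V z y)%:E).
Proof.
apply: (bounded_integrable F (V z) 1); first by rewrite ltey_eq fin_num_measure.
  exact: measurable_V_half2.
exact: V_half_le1.
Qed.

Lemma expected_V_half F z :
  expected (V_half alpha m) z F = (coverage F m (hval z) - alpha)%:E.
Proof.
rewrite /expected.
pose I : set (measurableTypeR R) := `[m - hval z, m + hval z]%classic.
have mI : measurable I by exact: measurable_itv.
transitivity (\int[F]_y ((\1_I y)%:E - alpha%:E))%E.
  by apply: eq_integral => y _; rewrite /V_half indicE mem_setE.
rewrite integralB_EFin//; last 2 first.
  - exact: integrable_indic.
  - exact: finite_measure_integrable_cst.
rewrite integral_indic// setIT integral_cst// [X in (_ * X)%E]probability_setT mule1.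
by rewrite /coverage EFinB fineK ?fin_num_measure.
Qed.

(** The real integral is [fine] of the extended one, and nothing is lost since a bounded integrand
    has a finite integral under a finite measure. The indicator replaces the domain [below x], so
    that Fubini can be used on the whole product space. *)
Lemma S_halfE mu x y :
  (S_half alpha m mu x y)%:E = (\int[mu]_z (\1_(below x) z * V z y)%:E)%E.
Proof.
rewrite /S_half /Rintegral integral_mkcond.
have -> : (EFin \o V ^~ y) \_ (below x) = (fun z => (\1_(below x) z * V z y)%:E).
  by apply/funext => z; rewrite patchE indicE; case: ifP; rewrite ?mul1r ?mul0r.
rewrite fineK// integrable_fin_num//.
apply: (bounded_integrable mu _ 1).
- by rewrite ltey_eq fin_num_measure.
  apply: measurable_funM; last exact: measurable_V_half1.
  by apply: measurable_indic; exact: measurable_below.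
move=> z; rewrite indicE; case: (_ \in _); rewrite ?mul1r ?mul0r ?V_half_le1//.
by rewrite normr0.
Qed.

Lemma S_half_measureE mu x y : (S_half alpha m mu x y)%:E =
  (mu (below x `&` [set z | (`|y - m| <= hval z)%R]) - alpha%:E * mu (below x))%E.
Proof.
have mB := measurable_below x.
have mC : measurable [set z : halfline R | (`|y - m| <= hval z)%R].
  have := measurable_xsection y (measurable_le_hval m).
  by rewrite xsectionE.
rewrite S_halfE.
transitivity (\int[mu]_z ((\1_(below x `&` [set z | `|y - m| <= hval z]) z)%:E -
    (alpha * \1_(below x) z)%:E))%E.
  apply: eq_integral => z _; rewrite /V V_halfE -EFinB; congr EFin.
  rewrite indicI/= mulrBr (mulrC alpha); congr (_ * _ - _).
  by rewrite indicE mem_setE.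
have iB : mu.-integrable [set: halfline R] (EFin \o \1_(below x)).
  apply: integrable_indic => //.
rewrite integralB_EFin//; last 2 first.
  - by apply: integrable_indic => //; exact: measurableI.
  - exact: (integrableZl _ _ iB).
rewrite integral_indic//; last exact: measurableI.
under [X in (_ - X)%E]eq_integral do rewrite EFinM.
by rewrite integralZl// integral_indic// !setIT.
Qed.

Let f x (p : measurableTypeR R * halfline R) : \bar R :=
  (\1_(below x) p.2 * V p.2 p.1)%:E.

Let integrable_f mu F x : (F \x mu)%E.-integrable setT (f x).
Proof.
have muF : ((F \x mu) [set: measurableTypeR R * halfline R] < +oo)%E.
  rewrite -setXTT product_measure1E//.
  by rewrite lte_mul_pinfty ?fin_num_measure// ltey_eq fin_num_measure.
apply: (bounded_integrable _ _ 1 muF).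
  apply: measurable_funM; last exact: measurable_V_half.
  apply: measurableT_comp; last exact: measurable_snd.
  by apply: measurable_indic; exact: measurable_below.
move=> [y z]; rewrite indicE/=; case: (_ \in _); rewrite ?mul1r ?mul0r ?V_half_le1//.
by rewrite normr0.
Qed.

Lemma integrable_S_half mu F x :
  F.-integrable [set: measurableTypeR R] (fun y => (S_half alpha m mu x y)%:E).
Proof.
rewrite (_ : (fun _ => _) = fubini_F mu (f x)); last first.
  by apply/funext => y; rewrite S_halfE.
exact: (integrable_fubini_F (integrable_f mu F x)).
Qed.

(** The density with respect to [mu] of the expected score at [x]: the Fubini integrand with the
    observation integrated out. *)
Definition score_density F x (z : halfline R) : R :=
  \1_(below x) z * (coverage F m (hval z) - alpha).

Let fubini_GE F x : fubini_G F (f x) = EFin \o score_density F x.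
Proof.
apply/funext => z; rewrite /fubini_G /f /score_density/=.
under eq_integral do rewrite EFinM.
by rewrite integralZl//; [rewrite -/(expected V z F) expected_V_half|exact: integrable_V_half].
Qed.

Lemma integrable_score_density mu F x :
  mu.-integrable [set: halfline R] (EFin \o score_density F x).
Proof.
apply: (bounded_integrable mu _ 1).
- by rewrite ltey_eq fin_num_measure.
- apply/measurable_EFinP.
  by rewrite -fubini_GE; exact: (measurable_fubini_G (integrable_f mu F x)).
move: alpha_gt0 alpha_lt1 => a0 a1 z.
have c0 : 0 <= coverage F m (hval z) by rewrite fine_ge0.
have c1 : coverage F m (hval z) <= 1.
  by rewrite -lee_fin fineK ?fin_num_measure// probability_le1.
rewrite /score_density indicE; case: (_ \in _); rewrite ?mul1r ?mul0r ?normr0//.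
by rewrite ler_norml; apply/andP; split; lra.
Qed.

Lemma expected_S_half mu F x :
  expected (S_half alpha m mu) x F = (\int[mu]_z (score_density F x z)%:E)%E.
Proof.
rewrite /expected; under eq_integral do rewrite S_halfE.
rewrite [LHS](Fubini (integrable_f mu F x)).
by apply: eq_integral => z _; rewrite -[LHS]/(fubini_G F (f x) z) fubini_GE.
Qed.

End expected_scores.

(** * Consistency and strict consistency *)

Lemma finite_has_expectations {R : realType} {A : Type} (M : set (distr R))
    (U : A -> R -> R) : finite_expectations M U -> has_expectations M U.
Proof.
move=> fin x F MF; have iU := fin x F MF; split.
  by apply/measurable_EFinP; exact: measurable_int iU.
by left; apply: integrable_lty => //; exact: integrable_funepos.
Qed.

Lemma continuous_hval {R : realType} : continuous (@hval R : halfline R -> R).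
Proof. exact: initial_continuous. Qed.

Lemma open_between {R : realType} (a b : R) :
  open [set z : halfline R | a < hval z < b].
Proof.
rewrite (_ : [set _ | _] = (@hval R : halfline R -> R) @^-1` `]a, b[%classic).
  by apply: open_comp; [move=> z _; exact: continuous_hval|exact: interval_open].
by apply/seteqP; split => z; rewrite /= in_itv.
Qed.

Lemma measurable_between {R : realType} (a b : R) :
  measurable [set z : halfline R | a < hval z < b].
Proof.
exists `]a, b[%classic; first exact: measurable_itv.
by rewrite setTI; apply/seteqP; split => z; rewrite /= in_itv.
Qed.

Section consistency.
Context {R : realType} (alpha m : R).
Hypotheses (alpha_gt0 : 0 < alpha) (alpha_lt1 : alpha < 1).
Variable F : distr R.
Hypothesis FM : M_inc_cont F.

Let t := b_half alpha m F.

Lemma coverage_lt_b_half (z : halfline R) :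
  hval z < hval t -> coverage F m (hval z) < alpha.
Proof.
move=> zt; rewrite -[ltRHS](coverage_b_half F FM alpha m)//.
by apply: coverage_increasing => //; exact: hval_ge0.
Qed.

Lemma coverage_gt_b_half (z : halfline R) :
  hval t < hval z -> alpha < coverage F m (hval z).
Proof.
move=> tz; rewrite -[ltLHS](coverage_b_half F FM alpha m)//.
by apply: coverage_increasing => //; exact: hval_ge0.
Qed.

Lemma coverage_eq_b_half (z : halfline R) :
  coverage F m (hval z) = alpha <-> z = t.
Proof.
split => [cz|->]; last exact: coverage_b_half.
apply: hval_inj; apply/eqP; rewrite eq_le !leNgt; apply/andP; split; apply/negP.
  by move/coverage_gt_b_half; rewrite cz ltxx.
by move/coverage_lt_b_half; rewrite cz ltxx.
Qed.

Let g x z := score_density alpha m F x z - score_density alpha m F t z.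

Lemma score_densityE (x z : halfline R) :
  score_density alpha m F x z = (hval z < hval x)%R%:R * (coverage F m (hval z) - alpha).
Proof. by rewrite /score_density indicE mem_setE. Qed.

(** The two indicators cancel unless [z] lies between [x] and [t]; there the surviving one carries
    the sign of [coverage - alpha], which changes at [t]. *)
Lemma score_density_sub_ge0 x z : 0 <= g x z.
Proof.
rewrite /g !score_densityE.
have [zx|xz] := ltP (hval z) (hval x); have [zt|tz] := ltP (hval z) (hval t);
  rewrite ?mul1r ?mul0r ?subrr ?subr0 ?sub0r//.
  rewrite subr_ge0; move: tz; rewrite le_eqVlt => /predU1P[tz|/coverage_gt_b_half/ltW//].
  by rewrite -tz coverage_b_half.
by rewrite oppr_ge0 subr_le0 ltW// coverage_lt_b_half.
Qed.

Lemma score_density_sub_gt0 x z :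
  hval x < hval z < hval t \/ hval t < hval z < hval x -> 0 < g x z.
Proof.
rewrite /g !score_densityE => -[|] /andP[h1 h2].
  by rewrite h2 (le_gtF (ltW h1)) mul0r mul1r sub0r oppr_gt0 subr_lt0 coverage_lt_b_half.
by rewrite h2 (le_gtF (ltW h1)) mul0r mul1r subr0 subr_gt0 coverage_gt_b_half.
Qed.

Variable mu : {finite_measure set (halfline R) -> \bar R}.
Let S := S_half alpha m mu.

Lemma expected_S_half_sub x :
  (\int[mu]_z (g x z)%:E = expected S x F - expected S t F)%E.
Proof.
rewrite !expected_S_half// -integralB_EFin//; exact: integrable_score_density.
Qed.

Lemma expected_S_half_fin_num x : expected S x F \is a fin_num.
Proof. by apply: integrable_fin_num => //; exact: integrable_S_half. Qed.

Lemma expected_S_half_min x : (expected S t F <= expected S x F)%E.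
Proof.
(* Finiteness of the expected score at [t] lets the inequality be read as nonnegativity of the
   difference. *)
rewrite -(sube_ge0 (introT orP (or_introl (expected_S_half_fin_num t)))).
rewrite -expected_S_half_sub.
by apply: integral_ge0 => z _; rewrite lee_fin score_density_sub_ge0.
Qed.

Lemma expected_S_half_eq x : positive_measure mu ->
  expected S t F = expected S x F -> x = t.
Proof.
move=> mu0 StSx; apply: contrapT => xt.
have g0 : (\int[mu]_z `|(g x z)%:E| = 0)%E.
  under eq_integral => z _.
    rewrite gee0_abs; last by rewrite lee_fin; exact: score_density_sub_ge0.
    over.
  rewrite expected_S_half_sub StSx subee; last exact: expected_S_half_fin_num.
  exact: erefl.
have mg : measurable_fun [set: halfline R] (EFin \o g x).
  have ig w := @integrable_score_density _ alpha m alpha_gt0 alpha_lt1 mu F w.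
  exact: (measurable_int _ (integrableB measurableT (ig x) (ig t))).
(* A zero integral of the absolute value confines the points where [g x] is nonzero to a null set
   [N]. *)
have {g0} [N [mN N0 gN]] := (ae_eq_integral_abs mu measurableT mg).1 g0.
(* Minimum and maximum treat both orders of [x] and [t] at once; the open set between them will lie
   inside [N]. *)
pose a := Num.min (hval x) (hval t); pose b := Num.max (hval x) (hval t).
have ab : a < b.
  rewrite /a /b; case: (ltgtP (hval x) (hval t)) => [xt'|tx|/hval_inj/xt[]].
    exact: xt'.
  exact: tx.
have a0 : 0 <= a by rewrite /a le_min !hval_ge0.
pose U := [set z : halfline R | a < hval z < b].
have UN : U `<=` N.
  move=> z Uz; apply: gN => /(_ I)[gz0]; suff : 0 < g x z by rewrite gz0 ltxx.
  apply: score_density_sub_gt0; move: Uz; rewrite /U /a /b/=.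
  case: (ltgtP (hval x) (hval t)) => [xt'|tx|/hval_inj/xt[]] Uz.
    by left.
  by right.
have : (0 < mu U)%E.
  apply: mu0; first exact: open_between.
  have mid : 0 <= (a + b) / 2 by lra.
  by exists (HalfLine mid); rewrite /U /hval/=; apply/andP; split; lra.
by rewrite (subset_measure0 (measurable_between a b) mN UN N0) ltxx.
Qed.

End consistency.

(** * A finite positive measure on the half-line: the law of the absolute value *)

Section folded_distribution.
Context {R : realType} (F : distr R).

Definition fold_halfline (y : measurableTypeR R) : halfline R :=
  HalfLine (normr_ge0 (y : R)).

Lemma measurable_fold_halfline : measurable_fun setT fold_halfline.
Proof.
move=> _ _ [B mB <-]; rewrite !setTI.
have mn : measurable_fun setT (fun y : R => `|y| : R).
  exact: normr_measurable.
by have := mn measurableT B mB; rewrite setTI; exact.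
Qed.

HB.instance Definition _ :=
  isMeasurableFun.Build _ _ _ _ fold_halfline measurable_fold_halfline.

Definition folded : {finite_measure set (halfline R) -> \bar R} :=
  distribution F fold_halfline.

(** A nonempty open set of the half-line contains a short interval to the right of one of its
    points, and a strictly increasing distribution function gives that interval positive mass. *)
Lemma positive_folded : M_inc_cont F -> positive_measure folded.
Proof.
move=> FM U [B oB BU] [u Uu].
have {Uu} Bu : B (hval u) by move: Uu; rewrite -BU.
have /nbhs_ballP[e /= e0 ue] : nbhs (hval u : R) B by exact: open_nbhs_nbhs.
have u0 := hval_ge0 u.
(* To the right of [u] all points are positive, so folding leaves them in place; [e / 2] keeps the
   closed right end inside the open ball. *)
have uU : `]hval u, hval u + e / 2]%classic `<=` fold_halfline @^-1` U.
  move=> y /=; rewrite in_itv/= => /andP[uy ye].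
  have -> : fold_halfline y = HalfLine (ltW (le_lt_trans u0 uy)).
    by apply: hval_inj; rewrite /hval/= gtr0_norm// (le_lt_trans u0).
  rewrite -BU; apply: ue; rewrite -[ball _ _ _]/(is_true (`|hval u - y| < e)).
  by rewrite ltr0_norm; lra.
have mU : measurable (fold_halfline @^-1` U).
  rewrite -[X in measurable X]setTI; apply: measurable_fold_halfline => //.
  by exists B; [exact: open_measurable|rewrite setTI].
apply: (@lt_le_trans _ _ (F `]hval u, hval u + e / 2]%classic)); last first.
  by rewrite le_measure ?inE.
rewrite -[F _]fineK ?fin_num_measure// distf_oc; last by lra.
by rewrite lte_fin subr_gt0; apply: distf_increasing => //; lra.
Qed.

End folded_distribution.

Theorem propositionA3 (R : realType) (alpha : R)
    (alpha_gt0 : 0 < alpha) (alpha_lt1 : alpha < 1) (m : R) :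
  (identifiable (@M_inc_cont R) (b_half alpha m) /\
   strict_identification_function (@M_inc_cont R) (b_half alpha m) (V_half alpha m)) /\
  (elicitable (@M_inc_cont R) (b_half alpha m) /\
   forall mu : {finite_measure set (halfline R) -> \bar R},
     [/\ forall (x : halfline R) (y : R),
           (S_half alpha m mu x y)%:E =
             (mu (below x `&` [set z | (`|y - m| <= hval z)%R])
              - alpha%:E * mu (below x))%E,
         consistent (@M_inc_cont R) (b_half alpha m) (S_half alpha m mu) &
         positive_measure mu ->
           strictly_consistent (@M_inc_cont R) (b_half alpha m) (S_half alpha m mu)]).
Proof.
have identV : strict_identification_function (@M_inc_cont R) (b_half alpha m)
    (V_half alpha m).
  split; first by apply: finite_has_expectations => x F _; exact: integrable_V_half.
  move=> x F FM; rewrite expected_V_half// -coverage_eq_b_half//.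
  by split => [[/eqP]|->]; rewrite ?subrr// subr_eq0 => /eqP.
have finS mu : finite_expectations (@M_inc_cont R) (S_half alpha m mu).
  by move=> x F _; exact: integrable_S_half.
have consS mu : consistent (@M_inc_cont R) (b_half alpha m) (S_half alpha m mu).
  split; first exact: finite_has_expectations.
  by move=> x F FM; exact: expected_S_half_min.
have strictS mu : positive_measure mu ->
    strictly_consistent (@M_inc_cont R) (b_half alpha m) (S_half alpha m mu).
  move=> mu0; split; first exact: consS.
  by move=> x F FM; exact: expected_S_half_eq.
split; first by split => //; exists (V_half alpha m).
split; last first.
  move=> mu; split; [exact: S_half_measureE|exact: consS|exact: strictS].
(* A strictly consistent score needs some finite positive measure: any member
   of the class, folded at 0, provides one, and for an empty class there is
   nothing to prove. *)
have [[F FM]|M0] := pselect (exists F : distr R, M_inc_cont F).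
  by exists (S_half alpha m (folded F)); split; [exact: finS|exact/strictS/positive_folded].
by exists (fun _ _ => 0); split; [|split; [split|]] => x F FM; case: M0; exists F.
Qed.
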